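(* Let $\mathscr H$ be a real Hilbert space, $\mathscr A\subseteq\mathscr H$ a closed linear subspace, $\mathsf Z$ a countable index set and $(h_k)_{k\in\mathsf Z}$ an orthogonal family of nonzero vectors of $\mathscr H$. Put $\hat h_k:=h_k/\|h_k\|$ and define the bounded linear operator $\hat S:\mathscr A\to\ell^2(\mathsf Z)$, $\hat S u:=(\langle u,\hat h_k\rangle)_{k\in\mathsf Z}$. Assume that the range $\mathrm{ran}(\hat S)$ is closed in $\ell^2(\mathsf Z)$. Let $\mathbf s=(\mathrm s_k)_{k\in\mathsf Z}$ be a real sequence whose normalized version $\hat{\mathbf s}:=(\mathrm s_k/\|h_k\|)_{k\in\mathsf Z}$ lies in $\ell^2(\mathsf Z)$, and let $u^{(0)}\in\mathscr A$. Then $(P_{\mathscr A}P_{\mathscr C_{\mathbf s}})^n u^{(0)}$ converges in norm as $n\to\infty$ and $$\lim_{n\to\infty}(P_{\mathscr A}P_{\mathscr C_{\mathbf s}})^n u^{(0)}=P_{\mathscr A\cap\mathscr C_{\bar{\mathbf s}}}\,u^{(0)}=u^{(0)}+\hat S^\dagger\big(\hat{\mathbf s}-\hat S u^{(0)}\big),$$ where $\bar{\mathbf s}=(\bar{\mathrm s}_k)_{k\in\mathsf Z}$ is the sequence defined by $\bar{\mathrm s}_k:=\|h_k\|\,\mathrm q_k$, with $(\mathrm q_k)_{k\in\mathsf Z}$ the orthogonal projection of $\hat{\mathbf s}$ onto $\mathrm{ran}(\hat S)$ in $\ell^2(\mathsf Z)$ (in particular $\mathscr A\cap\mathscr C_{\bar{\mathbf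 s}}\neq\emptyset$), and $\hat S^\dagger$ is the Moore–Penrose pseudo-inverse of $\hat S$.
   Context: For a real sequence $\mathbf t=(\mathrm t_k)_{k\in\mathsf Z}$, $\mathscr C_{\mathbf t}:=\{v\in\mathscr H:\ \langle v,h_k\rangle=\mathrm t_k\ \forall k\in\mathsf Z\}$. $P_{\mathscr V}$ denotes orthogonal projection (nearest-point map) onto a nonempty closed affine subspace $\mathscr V$; $P_{\mathscr A}$ is the orthogonal projection onto $\mathscr A$. $\ell^2(\mathsf Z)$ has its canonical norm $\|\cdot\|_2$. The Moore–Penrose pseudo-inverse is defined, for $\mathbf c\in\ell^2(\mathsf Z)$, by $\hat S^\dagger\mathbf c:=\arg\min_{v\in\mathscr M_{\mathbf c}}\|v\|$, where $\mathscr M_{\mathbf c}:=\{v\in\mathscr A:\ \|\hat S v-\mathbf c\|_2\ \text{is minimal}\}$. *)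

(* Defs.v *)
From HB Require Import structures.
From mathcomp Require Import all_boot all_order all_algebra.
From mathcomp Require Import all_classical all_reals all_analysis.
Set Implicit Arguments. Unset Strict Implicit. Unset Printing Implicit Defensive.
Import Order.TTheory GRing.Theory Num.Theory.
Import numFieldNormedType.Exports.
Local Open Scope classical_set_scope.
Local Open Scope ring_scope.

(* ip is an inner product on the normed space H inducing its norm:
   symmetric, linear in the first argument, and <v,v> = |v|^2.
   Together with H : completeNormedModType R this makes H a real Hilbert space. *)
Definition is_inner_product {R : realType} {H : normedModType R}
  (ip : H -> H -> R) : Prop :=
  [/\ forall u v, ip u v = ip v u,
      forall a u v w, ip (a *: u + v) w = a * ip u w + ip v w
    & forall v, ip v v = `|v| ^+ 2].

Definition is_subspace {R : realType} {H : normedModType R} (A : set H) : Prop :=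
  A 0 /\ forall a u v, A u -> A v -> A (a *: u + v).

(* A nearest point of x in S w.r.t. the distance d (arbitrary default x if
   no minimiser exists).  For a nonempty closed convex set in a Hilbert space
   this is the orthogonal projection / nearest-point map. *)
Definition nearest {T : choiceType} {R : realType} (d : T -> T -> R)
  (S : set T) (x : T) : T :=
  xget x [set p | S p /\ forall q, S q -> d x p <= d x q].

Section Hil.
Variables (R : realType) (H : normedModType R).

Definition hdist (u v : H) : R := `|u - v|.

Definition projV (V : set H) (x : H) : H := nearest hdist V x.

Definition Cset {Z : Type} (ip : H -> H -> R) (h : Z -> H) (t : Z -> R) : set H :=
  [set v | forall k, ip v (h k) = t k].
End Hil.

Section L2.
Variables (R : realType) (Z : countType).

Definition in_l2 (c : Z -> R) : Prop :=
  (\esum_(k in [set: Z]) ((c k) ^+ 2)%:E < +oo)%E.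

Definition l2norm (c : Z -> R) : R :=
  Num.sqrt (fine (\esum_(k in [set: Z]) ((c k) ^+ 2)%:E)).

Definition l2dist (c d : Z -> R) : R := l2norm (c - d).

(* closedness in l^2(Z) (sequential, equivalent to topological in a metric space) *)
Definition l2_closed (S : set (Z -> R)) : Prop :=
  forall (c : nat -> Z -> R) (x : Z -> R), in_l2 x -> (forall n, S (c n)) ->
    (fun n => l2dist (c n) x) @ \oo --> (0 : R) -> S x.
End L2.

Section Op.
Variables (R : realType) (H : normedModType R) (Z : countType).
Variables (ip : H -> H -> R) (h : Z -> H) (A : set H).

Definition Shat (u : H) : Z -> R := fun k => ip u ((`|h k|)^-1 *: h k).

Definition ranS : set (Z -> R) := [set Shat u | u in A].

Definition Mset (c : Z -> R) : set H :=
  [set v | A v /\ forall w, A w -> l2dist (Shat v) c <= l2dist (Shat w) c].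

Definition Spinv (c : Z -> R) : H :=
  xget 0 [set v | Mset c v /\ forall w, Mset c w -> `|v| <= `|w|].
End Op.

(* Main.v *)
Require Import Defs.
From HB Require Import structures.
From mathcomp Require Import all_boot all_order all_algebra.
From mathcomp Require Import all_classical all_reals all_analysis.
From mathcomp Require Import ring lra.
Set Implicit Arguments. Unset Strict Implicit. Unset Printing Implicit Defensive.
Import Order.TTheory GRing.Theory Num.Theory.
Import numFieldNormedType.Exports.
Local Open Scope classical_set_scope.
Local Open Scope ring_scope.

(** Let [N] be the set of vectors orthogonal to every [h k], [P_N] the projection
    onto it and [Q = 1 - P_N]. By Riesz-Fischer and Parseval, l^2 is isometric to
    the orthogonal complement of [N], with [Shat u] corresponding to [Q u]; so
    [shat = Shat g] with [g] orthogonal to [N], the closed range hypothesis says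
    that [Q A] is closed, and the projection of [shat] onto the range is [Shat v]
    with [v] in [A] and [g - Q v] orthogonal to [A]. Then
    [T u - v = P_A P_N (u - v)], whose iterates converge to [P_(A :&: N) (u0 - v)]
    by von Neumann's alternating projection theorem. Both [A :&: C_sbar] and
    [u0 + M_(shat - Shat u0)] equal [v + (A :&: N)]. *)

(** * Sequential closedness and a Cauchy criterion *)

Definition seq_closed {T : topologicalType} (V : set T) : Prop :=
  forall (w : nat -> T) (x : T), (forall n, V (w n)) -> w @ \oo --> x -> V x.

Lemma closed_seq_closed {T : topologicalType} (V : set T) :
  closed V -> seq_closed V.
Proof.
move=> cV w x Vw wx; apply: (closed_cvg V cV _ x wx).
exact: nearW.
Qed.

(** Squared distances bounded through the smaller index are what minimising sequences, iterates of a
    projection product and orthogonal partial sums all provide. *)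
Lemma cvgn_of_sq_dist_le {R : realType} {H : completeNormedModType R}
    (w : nat -> H) (r : nat -> R) :
  r @ \oo --> (0 : R) ->
  (forall n m, (n <= m)%N -> `|w n - w m| ^+ 2 <= r n) ->
  cvgn w.
Proof.
move=> r0 wr; apply: cauchy_cvg; apply: cauchy_exP => e e0.
have /cvgr0Pnorm_lt/(_ _ (exprn_gt0 2 e0)) [N _ HN] := r0.
exists (w N); exists N => // n /= Nn; rewrite -ball_normE /=.
rewrite -(@ltr_pXn2r _ 2)// ?nnegrE ?(ltW e0)//.
apply: (le_lt_trans (wr _ _ Nn)).
exact: le_lt_trans (ler_norm _) (HN N (leqnn _)).
Qed.

(** * Inner product identities and nearest points *)

Section InnerProduct.
Context {R : realType} {H : normedModType R} {ip : H -> H -> R}.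
Hypothesis ipP : is_inner_product ip.

Lemma ipC u v : ip u v = ip v u.
Proof. by case: ipP. Qed.

Lemma ipZDl a u v w : ip (a *: u + v) w = a * ip u w + ip v w.
Proof. by case: ipP. Qed.

Lemma ipvv v : ip v v = `|v| ^+ 2.
Proof. by case: ipP. Qed.

Lemma ipDl u v w : ip (u + v) w = ip u w + ip v w.
Proof. by rewrite -[u]scale1r ipZDl mul1r scale1r. Qed.

Lemma ip0l w : ip 0 w = 0.
Proof. by apply: (addrI (ip 0 w)); rewrite -ipDl !addr0. Qed.

Lemma ipZl a u w : ip (a *: u) w = a * ip u w.
Proof. by rewrite -[a *: u]addr0 ipZDl ip0l addr0. Qed.

Lemma ipNl u w : ip (- u) w = - ip u w.
Proof. by rewrite -scaleN1r ipZl mulN1r. Qed.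

Lemma ipBl u v w : ip (u - v) w = ip u w - ip v w.
Proof. by rewrite ipDl ipNl. Qed.

Lemma ipDr u v w : ip w (u + v) = ip w u + ip w v.
Proof. by rewrite ipC ipDl !(ipC w). Qed.

Lemma ip0r w : ip w 0 = 0.
Proof. by rewrite ipC ip0l. Qed.

Lemma ipZr a u w : ip w (a *: u) = a * ip w u.
Proof. by rewrite ipC ipZl ipC. Qed.

Lemma ipBr u v w : ip w (u - v) = ip w u - ip w v.
Proof. by rewrite ipC ipBl !(ipC w). Qed.

Lemma ip_ge0 v : 0 <= ip v v.
Proof. by rewrite ipvv exprn_ge0. Qed.

Lemma normB_sq u v : `|u - v| ^+ 2 = ip u u - 2 * ip u v + ip v v.
Proof. by rewrite -ipvv ipBl !ipBr (ipC v u); ring. Qed.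

Lemma pythagoras u v : ip u v = 0 -> `|u + v| ^+ 2 = `|u| ^+ 2 + `|v| ^+ 2.
Proof. by move=> uv; rewrite -!ipvv ipDl !ipDr (ipC v u) uv addr0 add0r. Qed.

Lemma cauchy_schwarz u v : `|ip u v| <= `|u| * `|v|.
Proof.
rewrite -(@ler_pXn2r _ 2)// ?nnegrE ?mulr_ge0// exprMn real_normK ?num_real//.
rewrite -!ipvv.
have [->|v0] := eqVneq v 0; first by rewrite !ip0r expr0n mulr0.
have vv : 0 < ip v v by rewrite ipvv exprn_gt0 ?normr_gt0.
(* Expanding this square gives [ip v v] times the Cauchy-Schwarz gap, without any division. *)
have := ip_ge0 (ip v v *: u - ip u v *: v).
rewrite ipBl !ipBr !ipZl !ipZr (ipC v u) => K.
have {}K : 0 <= ip v v * (ip u u * ip v v - ip u v ^+ 2).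
  by apply: (le_trans K); rewrite le_eqVlt; apply/orP; left; apply/eqP; ring.
by rewrite -subr_ge0 -(pmulr_rge0 _ vv).
Qed.

Lemma cvg_ipl (w : nat -> H) x y :
  w @ \oo --> x -> (fun n => ip (w n) y) @ \oo --> ip x y.
Proof.
move=> wx; apply/subr_cvg0.
apply: norm_cvg0.
have : (fun n => `|w n - x| * `|y|) @ \oo --> (0 : R).
  rewrite -[X in _ --> X](mul0r `|y|); apply: cvgM; last exact: cvg_cst.
  by rewrite -[X in _ --> X](@normr0 _ H); apply: cvg_norm; apply/subr_cvg0.
apply: squeeze_cvgr (cvg_cst 0); apply: nearW => n.
by rewrite normr_ge0 -ipBl cauchy_schwarz.
Qed.

Lemma cvg_norm_sq (w : nat -> H) x :
  w @ \oo --> x -> (fun n => `|w n| ^+ 2) @ \oo --> `|x| ^+ 2.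
Proof. by move=> wx; apply: cvgM; exact: cvg_norm. Qed.

Lemma seq_closed_Cset {Z : Type} (h : Z -> H) t : seq_closed (Cset ip h t).
Proof.
move=> w x Cw wx k; have := @cvg_ipl _ _ (h k) wx.
have -> : (fun n => ip (w n) (h k)) = cst (t k) by apply/funext => n; exact: Cw.
by move=> /(cvg_lim (@Rhausdorff R)) <-; rewrite lim_cst.
Qed.

(** By Pythagoras any other point of [V] is strictly farther from [x], so the choice made by [xget]
    is forced. Only differences from [p] enter, which covers affine sets such as [Cset]. *)
Lemma projV_eq (V : set H) x p :
  V p -> (forall v, V v -> ip (x - p) (v - p) = 0) -> projV V x = p.
Proof.
move=> Vp ort; rewrite /projV /nearest.
have D v : V v -> `|x - v| ^+ 2 = `|x - p| ^+ 2 + `|v - p| ^+ 2.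
  move=> Vv; rewrite -(normrN (v - p)) -pythagoras.
    by congr (`|_| ^+ 2); rewrite opprB addrA subrK.
  by rewrite ipC ipNl ipC ort// oppr0.
case: xgetP => [y _ [Vy ymin]|]; last first.
  move=> /(_ p) []; split => // v Vv; rewrite /hdist.
  by rewrite -(@ler_pXn2r _ 2)// ?nnegrE// (D v Vv) lerDl exprn_ge0.
have := ymin _ Vp; rewrite /hdist -(@ler_pXn2r _ 2)// ?nnegrE// (D y Vy).
rewrite gerDl => yp; apply/eqP; rewrite -subr_eq0 -normr_eq0 -sqrf_eq0.
by rewrite eq_le yp exprn_ge0.
Qed.

Section Subspace.
Variable V : set H.
Hypothesis subV : is_subspace V.

Lemma sub0 : V 0. Proof. by case: subV. Qed.

Lemma subZD a u v : V u -> V v -> V (a *: u + v).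
Proof. by case: subV => _; exact. Qed.

Lemma subD u v : V u -> V v -> V (u + v).
Proof. by rewrite -{2}[u]scale1r; exact: subZD. Qed.

Lemma subZ a u : V u -> V (a *: u).
Proof. by rewrite -[X in _ -> V X]addr0 => Vu; apply: subZD => //; exact: sub0. Qed.

Lemma subB u v : V u -> V v -> V (u - v).
Proof. by move=> Vu Vv; rewrite addrC -scaleN1r; exact: subZD. Qed.

(* First variation: perturb the minimiser [p] by [t *: v] with the optimal
   [t = ip (x - p) v / ip v v]. *)
Lemma minimiser_orthogonal x p :
  V p -> (forall v, V v -> `|x - p| <= `|x - v|) ->
  forall v, V v -> ip (x - p) v = 0.
Proof.
move=> Vp pmin v Vv.
have [->|v0] := eqVneq v 0; first by rewrite ip0r.
have vv : 0 < ip v v by rewrite ipvv exprn_gt0 ?normr_gt0.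
set c := ip (x - p) v; set t := c / ip v v.
have := pmin _ (subD Vp (subZ t Vv)).
rewrite -(@ler_pXn2r _ 2)// ?nnegrE// opprD addrA (normB_sq (x - p)) ipZl !ipZr -/c -ipvv.
rewrite divfK ?gt_eqF// => K.
have {}K : c ^+ 2 / ip v v <= 0 by rewrite expr2 -mulrA mulrC -/t; lra.
rewrite ler_pdivrMr// mul0r in K.
by apply/eqP; rewrite -sqrf_eq0 eq_le K sqr_ge0.
Qed.

End Subspace.
End InnerProduct.

(** * Projection onto a closed subspace *)

Section Projection.
Context {R : realType} {H : completeNormedModType R} {ip : H -> H -> R}.
Hypothesis ipP : is_inner_product ip.

(** A minimising sequence is Cauchy: midpoints stay in [V], so the parallelogram law bounds the
    distance between two of its terms. *)
Lemma exists_minimiser (V : set H) x : is_subspace V -> seq_closed V ->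
  exists2 p, V p & forall v, V v -> `|x - p| <= `|x - v|.
Proof.
move=> subV clV.
pose D := [set `|x - v| ^+ 2 | v in V].
have D0 : D !=set0 by exists (`|x - 0| ^+ 2); exists 0 => //; exact: (sub0 subV).
have Dlb : has_lbound D by exists 0 => _ [v _ <-]; rewrite exprn_ge0.
have Dinf v : V v -> inf D <= `|x - v| ^+ 2.
  by move=> Vv; apply: ge_inf => //; exists v.
have ex n : exists v, V v /\ `|x - v| ^+ 2 < inf D + n.+1%:R^-1.
  have [||_ [v Vv <-] ?] := @inf_adherent _ D n.+1%:R^-1; last by exists v.
  - by rewrite invr_gt0.
  - by split.
have /choice [w Hw] := ex.
(* The parallelogram law will leave at most [2/(n+1) + 2/(m+1)], hence [4/(n+1)] when [n <= m]. *)
have r0 : (fun n => 4 * n.+1%:R^-1) @ \oo --> (0 : R).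
  by rewrite -[X in _ --> X](mulr0 4); apply: cvgM; [exact: cvg_cst|exact: cvg_harmonic].
have /cvg_ex[/= p wp] : cvgn w.
  apply: (cvgn_of_sq_dist_le r0) => n m nm.
  have [Vn dn] := Hw n; have [Vm dm] := Hw m.
  have mid := Dinf _ (subZ subV 2^-1 (subD subV Vn Vm)).
  have le_inv : m.+1%:R^-1 <= n.+1%:R^-1 :> R.
    by rewrite lef_pV2 ?posrE// ler_nat.
  have par : `|w n - w m| ^+ 2 = 2 * `|x - w n| ^+ 2 + 2 * `|x - w m| ^+ 2
      - 4 * `|x - 2^-1 *: (w n + w m)| ^+ 2.
    rewrite !(normB_sq ipP) !(ipZl ipP) !(ipZr ipP) !(ipDl ipP) !(ipDr ipP).
    by rewrite (ipC ipP (w m) (w n)); field.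
  rewrite par; move: dn dm mid le_inv.
  move: (n.+1%:R^-1) (m.+1%:R^-1) (inf D) (`|_| ^+ 2) (`|_| ^+ 2) (`|_| ^+ 2).
  by move=> *; lra.
exists p; first by apply: clV wp => n; case: (Hw n).
have pinf : `|x - p| ^+ 2 <= inf D.
  have L : (fun n => `|x - w n| ^+ 2) @ \oo --> `|x - p| ^+ 2.
    by apply: cvg_norm_sq; apply: cvgB => //; exact: cvg_cst.
  have L' : (fun n => inf D + n.+1%:R^-1) @ \oo --> inf D.
    by rewrite -[X in _ --> X]addr0; apply: cvgD; [exact: cvg_cst|exact: cvg_harmonic].
  apply: (ler_cvg_to L L'); apply: nearW => n.
  by case: (Hw n) => _ /ltW.
move=> v Vv; rewrite -(@ler_pXn2r _ 2)// ?nnegrE//.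
exact: le_trans pinf (Dinf _ Vv).
Qed.

Section ProjSubspace.
Variable V : set H.
Hypotheses (subV : is_subspace V) (clV : seq_closed V).

Let projV_spec x : V (projV V x) /\ forall v, V v -> ip (x - projV V x) v = 0.
Proof.
have [p Vp pmin] := exists_minimiser x subV clV.
have ort := minimiser_orthogonal ipP subV Vp pmin.
suff -> : projV V x = p by [].
by apply: (projV_eq ipP) => // v Vv; apply: ort; exact: (subB subV).
Qed.

Lemma projV_in x : V (projV V x).
Proof. by case: (projV_spec x). Qed.

Lemma projV_ort x v : V v -> ip (x - projV V x) v = 0.
Proof. by case: (projV_spec x) => _; exact. Qed.

Lemma projV_unique x p :
  V p -> (forall v, V v -> ip (x - p) v = 0) -> projV V x = p.
Proof.
by move=> Vp ort; apply: (projV_eq ipP) => // v Vv; apply: ort; exact: (subB subV).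
Qed.

Lemma projV_id x : V x -> projV V x = x.
Proof. by move=> Vx; apply: projV_unique => // v _; rewrite subrr (ip0l ipP). Qed.

Lemma projVD x y : projV V (x + y) = projV V x + projV V y.
Proof.
apply: projV_unique; first by apply: (subD subV); exact: projV_in.
by move=> v Vv; rewrite opprD addrACA (ipDl ipP) !projV_ort// addr0.
Qed.

Lemma projVN x : projV V (- x) = - projV V x.
Proof.
apply: projV_unique.
  by rewrite -scaleN1r; apply: (subZ subV); exact: projV_in.
by move=> v Vv; rewrite -opprD (ipNl ipP) projV_ort// oppr0.
Qed.

Lemma projVB x y : projV V (x - y) = projV V x - projV V y.
Proof. by rewrite projVD projVN. Qed.

Lemma projV_ipl x v : V v -> ip (projV V x) v = ip x v.
Proof.
by move=> Vv; apply/esym/eqP; rewrite -subr_eq0 -(ipBl ipP) projV_ort.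
Qed.

(** Both sides equal the inner product of the two projections. *)
Lemma projV_sym x y : ip (projV V x) y = ip x (projV V y).
Proof.
rewrite -(projV_ipl _ (projV_in y)) (ipC ipP) -projV_ipl; last exact: projV_in.
exact: (ipC ipP).
Qed.

Lemma projV_pythagoras x :
  `|x| ^+ 2 = `|projV V x| ^+ 2 + `|x - projV V x| ^+ 2.
Proof.
rewrite addrC -(pythagoras ipP) ?subrK//.
by apply: projV_ort; exact: projV_in.
Qed.

Lemma projV_sq_le x : `|projV V x| ^+ 2 <= `|x| ^+ 2.
Proof. by rewrite [leRHS]projV_pythagoras lerDl exprn_ge0. Qed.

Lemma cvg_projV (w : nat -> H) x :
  w @ \oo --> x -> (fun n => projV V (w n)) @ \oo --> projV V x.
Proof.
move=> /subr_cvg0/(@cvg_norm _ _ _ _ _ _ _) wx; apply/subr_cvg0; apply: norm_cvg0.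
rewrite normr0 in wx.
apply: squeeze_cvgr (cvg_cst 0) wx; apply: nearW => n.
rewrite normr_ge0 /= -projVB -(@ler_pXn2r _ 2)// ?nnegrE//.
exact: projV_sq_le.
Qed.

End ProjSubspace.
End Projection.

(** * Von Neumann's alternating projections *)

Section AlternatingProjections.
Context {R : realType} {H : completeNormedModType R} {ip : H -> H -> R}.
Hypothesis ipP : is_inner_product ip.
Variables A N : set H.
Hypotheses (subA : is_subspace A) (clA : seq_closed A).
Hypotheses (subN : is_subspace N) (clN : seq_closed N).

Lemma is_subspaceI : is_subspace (A `&` N).
Proof.
split; first by split; [exact: (sub0 subA)|exact: (sub0 subN)].
by move=> a u v [Au Nu] [Av Nv]; split; [exact: (subZD subA)|exact: (subZD subN)].
Qed.

Lemma seq_closedI : seq_closed (A `&` N).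
Proof.
by move=> w x ANw wx; split; [apply: clA wx|apply: clN wx] => n; case: (ANw n).
Qed.

Let B x := projV A (projV N x).

Let B_in x : A (B x).
Proof. exact: (projV_in ipP). Qed.

Let iterB_in n x : A x -> A (iter n B x).
Proof. by case: n => // n _; exact: B_in. Qed.

(** Against vectors of [A] the outer projection drops out, leaving the self-adjoint [projV N]. *)
Let B_sym x y : A x -> A y -> ip (B x) y = ip x (B y).
Proof.
move=> Ax Ay; rewrite (projV_ipl ipP)// (projV_sym ipP)//.
by rewrite (ipC ipP x) -(projV_ipl ipP subA clA _ Ax) (ipC ipP).
Qed.

Let B_ip x : A x -> ip (B x) x = `|projV N x| ^+ 2.
Proof.
move=> Ax; rewrite (projV_ipl ipP)// -(ipvv ipP).
by rewrite (ipC ipP) -(projV_ipl ipP subN clN) //; exact: (projV_in ipP).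
Qed.

Let ip_iterB n m x : A x ->
  ip (iter n B x) (iter m B x) = ip (iter (n + m) B x) x.
Proof.
move=> Ax; elim: m n => [|m IH] n; first by rewrite addn0.
rewrite [iter m.+1 B x]iterS -B_sym; [|exact: iterB_in..].
by rewrite -iterS IH addnS addSn.
Qed.

Let ip_iterB_decr x : A x ->
  nonincreasing_seq (fun n => ip (iter n B x) x).
Proof.
move=> Ax; apply/nonincreasing_seqP => n.
(* With [y = B^m x], the values at [2m], [2m+1] and [2m+2] are the squared norms of [y], [projV N y]
   and [B y]; each arises from the previous vector by a projection. *)
rewrite -(odd_double_half n) -addnn; set m := n./2; set y := iter m B x.
have Ay : A y by exact: iterB_in.
have Ey : ip (iter (m + m).+1 B x) x = `|projV N y| ^+ 2.
  by rewrite -addSn -ip_iterB// iterS -/y B_ip.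
case: (odd n); rewrite [nat_of_bool _]/= ?add1n ?add0n.
  rewrite [leRHS]Ey -addSn -addnS -ip_iterB// !iterS -/y (ipvv ipP).
  exact: (projV_sq_le ipP).
rewrite [leLHS]Ey -ip_iterB// -/y (ipvv ipP).
exact: (projV_sq_le ipP).
Qed.

(* On [A], [B] is self-adjoint with [0 <= B <= 1], so [a n = ip (B^n x) x]
   decreases and [|B^n x - B^m x|^2 = a (2n) - 2 a (n + m) + a (2m)] is small. *)
Theorem alternating_projections x : A x ->
  (fun n => iter n (fun y => projV A (projV N y)) x) @ \oo
    --> projV (A `&` N) x.
Proof.
move=> Ax; rewrite -/B.
pose a n := ip (iter n B x) x.
have decr : nonincreasing_seq a := ip_iterB_decr Ax.
have a_ge0 n : 0 <= a n.
  apply: le_trans (decr _ _ (leq_addr n n)).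
  by rewrite /a -ip_iterB// (ip_ge0 ipP).
have lba : has_lbound (range a) by exists 0 => _ [n _ <-].
have ca := nonincreasing_cvgn decr lba.
have ge_inf_a n : inf (range a) <= a n by apply: ge_inf => //; exists n.
have ca2 : (fun n => a (n + n)%N - inf (range a)) @ \oo --> (0 : R).
  apply/subr_cvg0; apply: cvg_comp ca => //.
  apply/cvgnyPge => k; exists k => // n /= kn.
  exact: leq_trans kn (leq_addr _ _).
have /cvg_ex[/= y By] : cvgn (fun n => iter n B x).
  apply: (cvgn_of_sq_dist_le ca2) => n m nm.
  rewrite (normB_sq ipP) !ip_iterB// -/(a _) -/(a _) -/(a _).
  (* Since [a (n+m) >= a (2m) >= inf a], the expanded square is at most [a (2n) - inf a]. *)
  have h1 := decr (n + m)%N (m + m)%N (leq_add nm (leqnn m)).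
  have h2 := ge_inf_a (m + m)%N.
  rewrite /a in h1 h2 *; lra.
have Ay : A y by apply: clA By => n; exact: iterB_in.
have BBy : B y = y.
  have c1 : (fun n => iter n.+1 B x) @ \oo --> y by rewrite (cvg_shiftS (fun n => iter n B x)).
  have c2 : (fun n => iter n.+1 B x) @ \oo --> B y.
    by apply: (cvg_projV ipP) => //; exact: (cvg_projV ipP).
  exact: (cvg_unique _ c2 c1).
(* As [y] is a fixed point in [A], it has the same norm as [projV N y]; Pythagoras then leaves no
   component orthogonal to [N]. *)
have Ny : N y.
  have E : `|y| ^+ 2 = `|projV N y| ^+ 2 by rewrite -B_ip// BBy (ipvv ipP).
  have := projV_pythagoras ipP subN clN y; rewrite -E => /eqP.
  rewrite addrC -subr_eq subrr eq_sym sqrf_eq0 normr_eq0 subr_eq0 => /eqP ->.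
  exact: (projV_in ipP).
suff -> : projV (A `&` N) x = y by [].
apply: (projV_unique ipP is_subspaceI) => // v [Av Nv].
rewrite (ipBl ipP); apply/eqP; rewrite subr_eq0; apply/eqP.
(* [B] fixes [A :&: N] pointwise, so by self-adjointness the inner product of the iterates with [v]
   is constant and passes to the limit. *)
have Bv n : iter n B v = v.
  by elim: n => // n IH; rewrite iterS IH /B !(projV_id ipP).
have inv n : ip (iter n B x) v = ip x v.
  elim: n => // n IH; rewrite iterS B_sym//; last exact: iterB_in.
  by rewrite -/(iter 1 B v) Bv.
have c := @cvg_ipl _ _ _ ipP _ _ v By.
rewrite (funext inv) in c.
by have /(cvg_lim (@Rhausdorff R)) <- := c; rewrite lim_cst.
Qed.

End AlternatingProjections.

(** * Square-summable families and orthonormal systems *)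

Lemma esum_pickle {R : realType} {Z : countType} (a : Z -> \bar R) :
  (forall k, 0 <= a k)%E ->
  (\esum_(k in [set: Z]) a k =
   \sum_(i <oo) oapp a 0 (pickle_inv i : option Z))%E.
Proof.
move=> a0; pose b i := oapp a 0%E (pickle_inv i : option Z).
have b0 i : (0 <= b i)%E by rewrite /b; case: pickle_inv => //=.
have -> : (\esum_(k in [set: Z]) a k = \esum_(k in [set: Z]) b (pickle k))%E.
  by apply: eq_esum => k _; rewrite /b pickleK_inv.
rewrite -(esum_image [set: Z] pickle b); last first.
  by move=> k l _ _; exact: (pcan_inj pickleK).
rewrite nneseries_esumT// esum_mkcond; apply: eq_esum => i _.
case: ifPn => // /negP ni; rewrite /b; case E: pickle_inv => [k|]//=.
exfalso; apply: ni; rewrite inE; exists k => //.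
by have := @pickle_invK Z i; rewrite E.
Qed.

Section Orthonormal.
Context {R : realType} {H : completeNormedModType R} {ip : H -> H -> R}.
Hypothesis ipP : is_inner_product ip.
Context {Z : countType}.
Variable e : Z -> H.
Hypothesis orthonormal : forall k l, ip (e k) (e l) = (k == l)%:R.

(** Series over [Z] are run along [pickle_inv]; integers coding no index contribute 0, so finite and
    infinite [Z] are treated alike. *)
Let term (c : Z -> R) i : H := oapp (fun k => c k *: e k) 0 (pickle_inv i).
Let sqterm (c : Z -> R) i : R := oapp (fun k => c k ^+ 2) 0 (pickle_inv i : option Z).
Let part c n : H := \sum_(0 <= i < n) term c i.
Let psum c n : R := \sum_(0 <= i < n) sqterm c i.

Let partS c n : part c n.+1 = part c n + term c n.
Proof. by rewrite /part big_nat_recr. Qed.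

Let psumS c n : psum c n.+1 = psum c n + sqterm c n.
Proof. by rewrite /psum big_nat_recr. Qed.

Let sqterm_ge0 c i : 0 <= sqterm c i.
Proof. by rewrite /sqterm; case: pickle_inv => //= k; exact: sqr_ge0. Qed.

Let ip_part_e c n l : ip (part c n) (e l) = if (pickle l < n)%N then c l else 0.
Proof.
elim: n => [|n IH]; first by rewrite /part big_geq// (ip0l ipP).
rewrite partS (ipDl ipP) IH /term [in RHS]ltnS [in RHS]leq_eqVlt.
case E: pickle_inv => [k|] /=.
  have kn : pickle k = n by have := @pickle_invK Z n; rewrite E.
  rewrite (ipZl ipP) orthonormal -kn (inj_eq (pcan_inj pickleK)).
  have [->|] := eqVneq k l; first by rewrite ltnn add0r mulr1.
  by rewrite mulr0 addr0.
rewrite (ip0l ipP) addr0; case: eqVneq => //= ln.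
by have := pickleK_inv l; rewrite ln E.
Qed.

Let part_dist_sq c n m : (n <= m)%N ->
  `|part c n - part c m| ^+ 2 = psum c m - psum c n.
Proof.
move=> /subnKC <-; elim: (m - n)%N => [|d IH].
  by rewrite addn0 !subrr normr0 expr0n.
rewrite addnS partS psumS opprD addrA (pythagoras ipP).
  rewrite IH addrAC normrN; congr (_ + _).
  rewrite /term /sqterm; case: pickle_inv => [k|] /=; last by rewrite normr0 expr0n.
  by rewrite -(ipvv ipP) (ipZl ipP) (ipZr ipP) orthonormal eqxx mulr1 expr2.
(* Orthogonality of the new term to the earlier difference: an index coded by [n + d] occurs in
   neither partial sum. *)
rewrite (ipC ipP) (ipNl ipP) (ipC ipP) /term.
case E: pickle_inv => [k|] /=; last by rewrite (ip0r ipP) oppr0.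
have kn : pickle k = (n + d)%N by have := @pickle_invK Z (n + d); rewrite E.
by rewrite (ipZr ipP) (ipBl ipP) !ip_part_e kn ltnn ltnNge leq_addr subrr mulr0 oppr0.
Qed.

Let part_sq c n : `|part c n| ^+ 2 = psum c n.
Proof.
have p0 : part c 0 = 0 by rewrite /part big_geq.
have s0 : psum c 0 = 0 by rewrite /psum big_geq.
by have := @part_dist_sq c 0%N n isT; rewrite p0 s0 sub0r normrN subr0.
Qed.

Let psum_nd c : nondecreasing_seq (psum c).
Proof. by apply/nondecreasing_seqP => n; rewrite psumS lerDl. Qed.

(** Kept in the extended reals, without assuming summability, because [bessel] derives summability
    from it. *)
Let psum_cvg_ereal c :
  (fun n => (psum c n)%:E) @ \oo --> (\esum_(k in [set: Z]) (c k ^+ 2)%:E)%E.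
Proof.
rewrite esum_pickle; last by move=> k; rewrite lee_fin sqr_ge0.
have -> : (fun n => (psum c n)%:E) =
    (fun n => \sum_(0 <= i < n)
       oapp (fun k => (c k ^+ 2)%:E) 0 (pickle_inv i : option Z))%E.
  apply/funext => n; rewrite /psum -sumEFin; apply: eq_bigr => i _.
  by rewrite /sqterm; case: pickle_inv.
apply: is_cvg_nneseries => i _ _.
by case: pickle_inv => //= k; rewrite lee_fin sqr_ge0.
Qed.

Let psum_cvg c : in_l2 c -> psum c @ \oo --> l2norm c ^+ 2.
Proof.
move=> cl2; have E0 : (0 <= \esum_(k in [set: Z]) (c k ^+ 2)%:E)%E.
  by apply: esum_ge0 => k _; rewrite lee_fin sqr_ge0.
rewrite /l2norm sqr_sqrtr ?fine_ge0//.
have := @psum_cvg_ereal c.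
rewrite -[X in _ --> X -> _]fineK ?ge0_fin_numE//.
by move=> /fine_cvgP [].
Qed.

(** Positivity of [|v - part c n|^2 = |v|^2 - psum c n] bounds all partial sums. *)
Lemma bessel v : in_l2 (fun k => ip v (e k)).
Proof.
set c := fun k => _.
apply: (@le_lt_trans _ _ (`|v| ^+ 2)%:E); last exact: ltry.
have cv := @psum_cvg_ereal c.
rewrite -(cvg_lim (@ereal_hausdorff R) cv).
apply: lime_le; first by apply/cvg_ex; eexists; exact: cv.
apply: nearW => n; rewrite lee_fin.
have ipp : ip v (part c n) = psum c n.
  elim: n => [|n IH]; first by rewrite /part /psum !big_geq// (ip0r ipP).
  rewrite partS psumS (ipDr ipP) IH; congr (_ + _).
  rewrite /term /sqterm; case: pickle_inv => [k|] /=; last exact: (ip0r ipP).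
  by rewrite (ipZr ipP) expr2.
have := exprn_ge0 2 (normr_ge0 (v - part c n)).
rewrite (normB_sq ipP) ipp !(ipvv ipP) part_sq; lra.
Qed.

(** [g] is the sum of the series of [c k *: e k], Cauchy because its squared increments are those of
    [psum c]. Each property holds for partial sums, at least eventually, and passes to the limit. *)
Lemma riesz_fischer c : in_l2 c ->
  exists g, [/\ forall k, ip g (e k) = c k,
    forall v, (forall k, ip v (e k) = 0) -> ip g v = 0
    & `|g| = l2norm c].
Proof.
move=> cl2; have cp := psum_cvg cl2.
have r0 : (fun n => l2norm c ^+ 2 - psum c n) @ \oo --> (0 : R).
  by rewrite -[X in _ --> X](subrr (l2norm c ^+ 2)); apply: cvgB cp; exact: cvg_cst.
have /cvg_ex[/= g cg] : cvgn (part c).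
  apply: (cvgn_of_sq_dist_le r0) => n m nm; rewrite part_dist_sq// lerD2r.
  rewrite -(cvg_lim (@Rhausdorff R) cp); apply: nondecreasing_cvgn_le => //.
  by apply/cvg_ex; eexists; exact: cp.
exists g; split.
- move=> k; have ck := @cvg_ipl _ _ _ ipP _ _ (e k) cg.
  rewrite -(cvg_lim (@Rhausdorff R) ck); apply: (cvg_lim (@Rhausdorff R)).
  apply: cvg_near_cst; exists (pickle k).+1 => // n /= kn.
  by rewrite ip_part_e kn.
- move=> v vN; have ck := @cvg_ipl _ _ _ ipP _ _ v cg.
  rewrite -(cvg_lim (@Rhausdorff R) ck); apply: (cvg_lim (@Rhausdorff R)).
  apply: cvg_near_cst; apply: nearW => n.
  elim: n => [|n IH]; first by rewrite /part big_geq// (ip0l ipP).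
  rewrite partS (ipDl ipP) IH add0r /term.
  case: pickle_inv => [k|] /=; last exact: (ip0l ipP).
  by rewrite (ipZl ipP) (ipC ipP) vN mulr0.
- have := cvg_norm_sq cg; rewrite (funext (part_sq c)) => c2.
  have sq : `|g| ^+ 2 = l2norm c ^+ 2 by exact: (cvg_unique _ c2 cp).
  by move/eqP: sq; rewrite eqrXn2 ?sqrtr_ge0// => /eqP.
Qed.

Let N := Cset ip e (fun=> 0).

Lemma is_subspace_Cset0 : is_subspace N.
Proof.
split=> [k|a u v Nu Nv k]; first exact: (ip0l ipP).
by rewrite (ipZDl ipP) Nu Nv mulr0 addr0.
Qed.

(** The vector that [riesz_fischer] builds from the coefficients of [v] is the component of [v]
    orthogonal to [N]. *)
Lemma parseval v : l2norm (fun k => ip v (e k)) = `|v - projV N v|.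
Proof.
have [g [ge gN <-]] := riesz_fischer (bessel v).
suff -> : projV N v = v - g by rewrite subKr.
apply: (projV_unique ipP is_subspace_Cset0).
  by move=> k; rewrite (ipBl ipP) ge subrr.
by move=> w Nw; rewrite subKr gN.
Qed.

(** This isometry carries closedness and best approximation between l^2 and the space. *)
Lemma parseval_dist u v :
  l2dist (fun k => ip u (e k)) (fun k => ip v (e k))
  = `|(u - projV N u) - (v - projV N v)|.
Proof.
have -> : (u - projV N u) - (v - projV N v) = (u - v) - projV N (u - v).
  rewrite (projVB ipP is_subspace_Cset0); last exact: (seq_closed_Cset ipP).
  by rewrite !opprD !opprK addrACA.
rewrite -parseval /l2dist; congr (l2norm _); apply/funext => k.
by rewrite (ipBl ipP).
Qed.

End Orthonormal.

(** * Limit of the iteration and the pseudo-inverse formula *)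

Theorem theorem1 (R : realType) (H : completeNormedModType R)
  (ip : H -> H -> R) (Z : countType) (h : Z -> H) (A : set H)
  (s : Z -> R) (u0 : H) :
  is_inner_product ip ->
  is_subspace A -> closed A ->
  (forall k, h k != 0) ->
  (forall k l, k != l -> ip (h k) (h l) = 0) ->
  l2_closed (ranS ip h A) ->
  in_l2 (fun k => s k / `|h k|) ->
  A u0 ->
  let shat := fun k => s k / `|h k| in
  let q := nearest (@l2dist R Z) (ranS ip h A) shat in
  let sbar := fun k => `|h k| * q k in
  let T := fun u : H => projV A (projV (Cset ip h s) u) in
  (A `&` Cset ip h sbar !=set0) /\
  ((fun n => iter n T u0) @ \oo --> projV (A `&` Cset ip h sbar) u0) /\
  projV (A `&` Cset ip h sbar) u0
    = u0 + Spinv ip h A (shat - Shat ip h u0).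
Proof.
move=> ipP subA /closed_seq_closed clA h0 horth clran sl2 Au0 shat q sbar T.
pose e k := `|h k|^-1 *: h k.
have on k l : ip (e k) (e l) = (k == l)%:R.
  rewrite (ipZl ipP) (ipZr ipP); have [<-|kl] := eqVneq k l.
    by rewrite (ipvv ipP) expr2 mulKf ?mulVf ?normr_eq0.
  by rewrite horth// !mulr0.
(* Normalising the family divides the data by [|h k|], turning [s] into [shat] and [sbar] into
   [q]. *)
have CsetE t t' : (forall k, t k = `|h k| * t' k) -> Cset ip h t = Cset ip e t'.
  move=> tt; apply/seteqP; split=> v /= Cv k; have := Cv k.
    by rewrite (ipZr ipP) tt => ->; rewrite mulKf// normr_eq0.
  by rewrite (ipZr ipP) tt => <-; rewrite mulVKf// normr_eq0.
have Cs : Cset ip h s = Cset ip e shat.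
  by apply: CsetE => k; rewrite /shat mulrC divfK// normr_eq0.
have Cq : Cset ip h sbar = Cset ip e q by exact: CsetE.
rewrite {}Cq; rewrite {}Cs in T *.
set N := Cset ip e (fun=> 0).
have subN : is_subspace N := is_subspace_Cset0 ipP e.
have clN : seq_closed N := seq_closed_Cset ipP (h := e) (t := fun=> 0).
have subAN := is_subspaceI subA subN.
have clAN := seq_closedI clA clN.
pose S := Shat ip h.
pose Q x := x - projV N x.
have QN x v : N v -> ip (Q x) v = 0 by exact: (projV_ort ipP).
have QB x y : Q (x - y) = Q x - Q y.
  by rewrite /Q (projVB ipP)// !opprD !opprK addrACA.
have QP x : N (x - Q x) by rewrite subKr; exact: (projV_in ipP).
have Q_eq x y : N (x - y) -> Q x = Q y.
  move=> Nxy; apply/eqP; rewrite -subr_eq0 -QB /Q (projV_id ipP)//.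
  by rewrite subrr.
have Q_id x : (forall v, N v -> ip x v = 0) -> Q x = x.
  move=> xN; suff -> : Q x = x - 0 by rewrite subr0.
  congr (_ - _); apply: (projV_unique ipP subN); first exact: (sub0 subN).
  by move=> v Nv; rewrite subr0 xN.
have distS u v : l2dist (S u) (S v) = `|Q u - Q v| := parseval_dist ipP on u v.
have SB u v : S u - S v = S (u - v).
  by apply/funext => k; rewrite /S /Shat (ipBl ipP).
have [g [ge gN _]] := riesz_fischer ipP on sl2.
have Sg : S g = shat by apply/funext => k; exact: ge.
have Qg : Q g = g := Q_id _ gN.
(* [W] is the isometric copy of the range of [S] inside the space. *)
pose W := Q @` A.
have subW : is_subspace W.
  split; first by exists 0; [exact: (sub0 subA)|apply: Q_id => v _; exact: (ip0l ipP)].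
  move=> a _ _ [x Ax <-] [y Ay <-]; exists (a *: x + y); first exact: (subZD subA).
  rewrite -[RHS]Q_id; last first.
    by move=> v Nv; rewrite (ipZDl ipP) !QN// mulr0 addr0.
  apply: Q_eq; rewrite opprD addrACA -scalerBr.
  by apply: (subZD subN); exact: QP.
have clW : seq_closed W.
  move=> w x Ww wx.
  have /choice[a Ha] : forall n, exists a, A a /\ Q a = w n.
    by move=> n; have [a Aa <-] := Ww n; exists a.
  have Qx : Q x = x.
    apply: Q_id => v Nv; have c := @cvg_ipl _ _ _ ipP _ _ v wx.
    rewrite -(cvg_lim (@Rhausdorff R) c); apply: (cvg_lim (@Rhausdorff R)).
    apply: cvg_near_cst; apply: nearW => n.
    by have [_ <-] := Ha n; exact: QN.
  (* The limit is taken in l^2: closed range gives [b] in [A] with [S b = S x], so [b - x] lies in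
     [N] and [Q b = Q x = x]. *)
  have [||b Ab Sb] := clran (fun n => S (a n)) (S x) (bessel ipP on x).
  - by move=> n; exists (a n) => //; case: (Ha n).
  - have -> : (fun n => l2dist (S (a n)) (S x)) = (fun n => `|w n - x|).
      by apply/funext => n; rewrite distS Qx; have [_ ->] := Ha n.
    by rewrite -[X in _ --> X](@normr0 _ H); apply: cvg_norm; apply/subr_cvg0.
  exists b => //; rewrite -[RHS]Qx; apply: Q_eq => k.
  by rewrite (ipBl ipP); apply/eqP; rewrite subr_eq0; apply/eqP; exact: (congr1 (@^~ k) Sb).
have [v [Av qE vmin]] : exists v, [/\ A v, q = S v
    & forall b, A b -> `|g - Q v| <= `|g - Q b|].
  rewrite /q /nearest; case: xgetP => [p _ [[v Av <-] pmin]|].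
    exists v; split => // b Ab.
    have := pmin (S b) (ex_intro2 _ _ b Ab erefl).
    by rewrite -Sg !distS Qg.
  (* The default branch of [nearest] is impossible, since the closest point of [W] to [g] yields a
     minimiser in the range. *)
  have [_ [v Av <-] vmin] := exists_minimiser ipP g subW clW.
  move=> /(_ (S v)) []; split; first by exists v.
  by move=> _ [b Ab <-]; rewrite -Sg !distS Qg; apply: vmin; exists b.
have gW x : A x -> (forall b, A b -> `|g - Q x| <= `|g - Q b|) ->
    projV W g = Q x.
  move=> Ax xmin; apply: (projV_unique ipP subW); first by exists x.
  apply: (minimiser_orthogonal ipP subW); first by exists x.
  by move=> _ [b Ab <-]; exact: xmin.
(* Split [b] as [(b - Q b) + Q b]: the first part lies in [N], to which [g] and [Q v] are
   orthogonal; the second lies in [W], where [Q v] is the projection of [g]. *)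
have gA b : A b -> ip (g - Q v) b = 0.
  move=> Ab; rewrite -[b](subrK (Q b)) (ipDr ipP).
  rewrite (ipBl ipP) (gN _ (QP b)) (QN _ _ (QP b)) subrr add0r.
  by rewrite -(gW _ Av vmin); apply: (projV_ort ipP) => //; exists b.
(* The constraint set for [q] is [v + N], so this is the projection onto [A :&: N] translated by
   [v]. *)
pose us := v + projV (A `&` N) (u0 - v).
have [Ap Np] : (A `&` N) (projV (A `&` N) (u0 - v)) by exact: (projV_in ipP).
have CqE w : Cset ip e q w <-> N (w - v).
  split=> Cw k; have := Cw k; rewrite (ipBl ipP) qE.
    by move=> ->; rewrite subrr.
  by move/eqP; rewrite subr_eq0 => /eqP.
have us_in : (A `&` Cset ip e q) us.
  by split; [exact: (subD subA)|apply/CqE; rewrite /us addrC addKr].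
have us_ort w : A w -> N (w - v) -> ip (u0 - us) (w - us) = 0.
  move=> Aw Nw; have -> : u0 - us = (u0 - v) - projV (A `&` N) (u0 - v).
    by rewrite /us opprD addrA.
  apply: (projV_ort ipP) => //; split.
    by apply: (subB subA) => //; case: us_in.
  by rewrite /us opprD addrA; exact: (subB subN).
have usE : projV (A `&` Cset ip e q) u0 = us.
  by apply: (projV_eq ipP) => // w [Aw /CqE Nw]; exact: us_ort.
split; first by exists us.
rewrite usE; split.
  have TE u : T u = v + projV A (projV N (u - v)).
    (* The constraint set for [shat] is [g + N], and [g] is orthogonal to [N]. *)
    have -> : T u = projV A (projV N u + g).
      rewrite /T; congr (projV A _); apply: (projV_eq ipP).
        move=> k; rewrite (ipDl ipP) ge.
        by have -> := projV_in ipP subN clN u k; rewrite add0r.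
      move=> w Cw.
      have Nd : N (w - (projV N u + g)).
        move=> k; rewrite (ipBl ipP) (ipDl ipP) ge Cw.
        by have -> := projV_in ipP subN clN u k; rewrite add0r subrr.
      move: (w - _) Nd => d Nd; rewrite opprD addrA (ipBl ipP).
      by rewrite gN// (projV_ort ipP)// subrr.
    (* Uses [v = projV N v + Q v]; the middle term is then killed by [projV A] thanks to [gA]. *)
    have -> : projV N u + g = projV N (u - v) + (g - Q v) + v.
      rewrite (projVB ipP)// /Q opprB (addrA g) -[RHS]addrA subrK addrACA.
      by rewrite addNr addr0.
    rewrite 2!(projVD ipP subA clA) (projV_id ipP subA Av) addrC; congr (_ + _).
    suff -> : projV A (g - Q v) = 0 by rewrite addr0.
    apply: (projV_unique ipP subA); first exact: (sub0 subA).
    by move=> b Ab; rewrite subr0 gA.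
  have iterE n :
      iter n T u0 = v + iter n (fun y => projV A (projV N y)) (u0 - v).
    by elim: n => [|n IH]; rewrite ?subrKC// iterS IH TE addrAC subrr add0r.
  rewrite (funext iterE); apply: cvgD; first exact: cvg_cst.
  by apply: (alternating_projections ipP) => //; exact: (subB subA).
(* Minimal norm means nearest to 0, and the [xget] defaults agree: both are 0. *)
have SpinvE c : Spinv ip h A c = projV (Mset ip h A c) 0.
  rewrite /Spinv /projV /nearest; congr (xget _ _); apply/seteqP.
  by split=> x [Mx xmin]; split=> // y My; have := xmin y My;
    rewrite /hdist !sub0r !normrN.
(* After translation by [u0], membership says that [u0 + x] is a best approximation of [g] through
   [Q]; by [gW] all of these share the value [Q v]. *)
have MsetE x : Mset ip h A (shat - S u0) x <-> A x /\ N (u0 + x - v).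
  have D y : l2dist (S y) (shat - S u0) = `|g - Q (u0 + y)|.
    have -> : S y = S (u0 + y - u0) by rewrite [u0 + y]addrC addrK.
    by rewrite -Sg SB distS !QB Qg [- (g - _)]opprB addrA subrK distrC.
  split=> [[Ax xmin]|[Ax Nx]].
    split=> //; suff E : Q (u0 + x) = Q v.
      have := QP (u0 + x - v).
      by rewrite QB E subrr subr0.
    rewrite -(gW _ Av vmin); apply/esym/gW; first exact: (subD subA).
    move=> b Ab; have := xmin (b - u0) (subB subA Ab Au0).
    by rewrite !D subrKC.
  split=> // y Ay; rewrite !D (Q_eq _ _ Nx); apply: vmin.
  exact: (subD subA).
suff -> : Spinv ip h A (shat - S u0) = us - u0 by rewrite subrKC.
(* Translated by [u0], the orthogonality to check becomes [us_ort] at [u0 + x]. *)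
rewrite SpinvE; apply: (projV_eq ipP).
  apply/MsetE; split; first by case: us_in => Aus _; exact: (subB subA).
  by rewrite subrKC; apply/CqE; case: us_in.
move=> x /MsetE [Ax Nx].
have -> : x - (us - u0) = (u0 + x) - us by rewrite opprB addrA [x + _]addrC.
by rewrite sub0r opprB; apply: us_ort => //; exact: (subD subA).
Qed.
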